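(* Let $c_j,q_j>0$ for $j\in\{1,2,3\}$, let $b\in\mathbb R\setminus\{0\}$, put $c=\mathrm{diag}(c_1,c_2,c_3)$, $q=\mathrm{diag}(q_1,q_2,q_3)$ and $$\mathbb B=\begin{pmatrix}0&0&0\\1&0&0\\0&1&0\end{pmatrix},\qquad K=\begin{pmatrix}b&0&0\\0&0&0\\0&0&0\end{pmatrix}.$$ Then the system of heat equations on the path $$\begin{cases}\partial_tz(t,x)=c\,\partial_{xx}z(t,x)-q\,z(t,x),&t\ge0,\ x\in(0,1),\\ z(0,x)=h(x)\ge 0,&x\in(0,1),\\ \partial_xz(t,1)=\mathbb Bz(t,0)+Ku(t),&t\ge0,\\ \partial_xz(t,0)=0,&t\ge 0,\end{cases}$$ with state space $X=L^2([0,1])^3$, is not approximately controllable with respect to a positive control acting on the starting node.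
   Context: Here $z=(z_1,z_2,z_3)^\top$ and the control $u$ takes values in $\mathbb R^3$ (only its first component acts, since only the $(1,1)$ entry of $K$ is nonzero); it is positive if $u(t)\in\mathbb R^3_+$ for a.e. $t$. For $u\in L^2$ the system has a unique mild solution in $X$ with initial state $h$, denoted $z(t;h,u)$. Approximate controllability with respect to positive controls means that $\bigcup_{\tau>0}\{z(\tau;0,u):u\in L^2([0,\tau];\mathbb R^3),\ u\ge0\text{ a.e.}\}$ is dense in $X$. *)

(* Defs.v *)
From HB Require Import structures.
From mathcomp Require Import all_boot all_order all_algebra.
From mathcomp Require Import all_classical all_reals all_analysis.
Set Implicit Arguments.
Unset Strict Implicit.
Unset Printing Implicit Defensive.
Import Order.TTheory GRing.Theory Num.Theory.
Import numFieldNormedType.Exports.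
Local Open Scope classical_set_scope.
Local Open Scope ring_scope.

Notation leb := (@lebesgue_measure _).

Definition leb_itv {R : realType} (a b : R) :
    {measure set (measurableTypeR R) -> \bar R} :=
  mrestr leb (measurable_itv `[a, b]).

(* Elements of L^2([a, b]; R^n) are handled through representatives defined
   (and measurable) on the whole line; only their values on [a, b] matter. *)
Definition L2 {R : realType} {n : nat} (a b : R) : set (R -> 'cV[R]_n) :=
  [set f | forall i, (fun x => f x i 0) \in Lfun (leb_itv a b) 2%:E].

Definition vint {R : realType} {n : nat} (a b : R) (f : R -> 'cV[R]_n) :
    'cV[R]_n :=
  \col_i \int[leb]_(x in `[a, b]) (f x i 0).

Section StateSpace.
Context {R : realType} {n : nat}.
Implicit Types f g w : R -> 'cV[R]_n.

Definition X : set (R -> 'cV[R]_n) := L2 0 1.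

Definition Xdot f g : R :=
  \sum_(i < n) \int[leb]_(x in `[0, 1]) (f x i 0 * g x i 0).

Definition Xnorm f : R := Num.sqrt (Xdot f f).

Definition Xdense (S : set (R -> 'cV[R]_n)) : Prop :=
  forall f, X f -> forall e : R, 0 < e ->
    exists2 g, S g & Xnorm (fun x => f x - g x) < e.

Definition Xcontinuous (tau : R) (z : R -> R -> 'cV[R]_n) : Prop :=
  forall t, t \in `[0, tau] ->
    Xnorm (fun x => z s x - z t x) @[s --> within `[0, tau] (nbhs t)]
      --> (0 : R).

(* [w] represents the X-valued integral of [z] over [0, t], defined by testing
   against the dual of the Hilbert space X. *)
Definition Xintegral (t : R) (z : R -> R -> 'cV[R]_n) w : Prop :=
  forall phi, X phi -> Xdot w phi = \int[leb]_(s in `[0, t]) Xdot (z s) phi.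

(* [w] is the C^1 representative of an element of H^2(0,1)^n, with
   derivatives [dw] and [ddw]; the traces at 0 and 1 are thus point values. *)
Definition H2 w dw ddw : Prop :=
  X ddw /\
  forall x, x \in `[0, 1] ->
    w x = w 0 + vint 0 x dw /\ dw x = dw 0 + vint 0 x ddw.

End StateSpace.

Section HeatSystem.
Context {R : realType} {n : nat}.
Variables (c q B K : 'M[R]_n).

(* Mild solution on [0, tau] of
     z_t = c z_xx - q z,  z_x(t,1) = B z(t,0) + K u(t),  z_x(t,0) = 0,  z(0) = h
   in the time-integrated sense: z is continuous with values in X and, for each
   t, the integral of z over [0, t] is in H^2, satisfies the time-integrated
   boundary conditions, and is mapped by c d_xx - q to z(t) - h. *)
Definition mild_solution (tau : R) (h : R -> 'cV[R]_n) (u : R -> 'cV[R]_n)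
    (z : R -> R -> 'cV[R]_n) : Prop :=
  [/\ forall t, t \in `[0, tau] -> X (z t),
      Xcontinuous tau z &
      forall t, t \in `[0, tau] -> exists w dw ddw,
        [/\ H2 w dw ddw,
            Xintegral t z w,
            {ae leb_itv 0 1, forall x,
               z t x - h x = c *m ddw x - q *m w x},
            dw 1 = B *m w 0 + K *m vint 0 t u &
            dw 0 = 0]].

Definition positive_control (tau : R) : set (R -> 'cV[R]_n) :=
  [set u | L2 0 tau u /\
    {ae leb_itv 0 tau, forall t, forall i, 0 <= u t i 0}].

Definition positive_reachable : set (R -> 'cV[R]_n) :=
  [set f | exists tau u z,
    [/\ 0 < tau, positive_control tau u,
        mild_solution tau (fun=> 0) u z & f = z tau]].

Definition approx_controllable_positive : Prop := Xdense positive_reachable.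

End HeatSystem.

Definition path_adjacency (R : realType) : 'M[R]_3 :=
  \matrix_(i, j) (i == j.+1 :> nat)%:R.

Definition start_control (R : realType) (b : R) : 'M[R]_3 :=
  \matrix_(i, j) (if (i == 0) && (j == 0) then b else 0).

(* Main.v *)
(** Integrating the equation of the starting node over [0, 1] decouples it from
    the rest of the path: since the first row of the adjacency matrix vanishes,
    the normalised mean m(t) = (1/b) int_0^1 z_1(t, x) dx satisfies
      m(t) = c_1 int_0^t u_1(s) ds - q_1 int_0^t m(s) ds.
    For u_1 >= 0 this forces m >= 0, so the positively reachable states lie in
    the closed half-space where (1/b) int_0^1 z_1 >= 0, and the constant state -b
    is at distance at least |b| from it. *)

Require Import Defs.
From mathcomp Require Import all_boot all_order all_algebra.
From mathcomp Require Import all_classical all_reals all_analysis.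
From mathcomp Require Import ring lra.
Import Order.TTheory GRing.Theory Num.Theory.
Import numFieldNormedType.Exports.
Local Open Scope classical_set_scope.
Local Open Scope ring_scope.

(** * Integration on compact intervals *)

Lemma integrable_leb_itv {R : realType} (a b : R)
    (f : measurableTypeR R -> \bar R) :
  (leb_itv a b).-integrable setT f -> leb.-integrable `[a, b] f.
Proof.
move=> intf.
have /integrableP[mf finf] : (leb_itv a b).-integrable `[a, b] f.
  by apply: integrableS intf.
apply/integrableP; split => //.
rewrite (@eq_measure_integral _ _ _ _ (leb_itv a b))// => A mA Aab.
by rewrite /leb_itv /= /mrestr setIidl.
Qed.

(** An exceptional set for the restricted measure becomes Lebesgue-null once intersected with the
    interval. *)
Lemma ae_leb_itv {R : realType} (a b : R) (P : R -> Prop) :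
  {ae leb_itv a b, forall x, P x} ->
  {ae @lebesgue_measure R, forall x, `[a, b]%classic x -> P x}.
Proof.
move=> [A [mA A0 PA]]; exists (A `&` `[a, b]); split => //.
- exact: measurableI.
- by move=> x /= /not_implyP[abx nPx]; split => //; exact: PA.
Qed.

Section L2Itv.
Context {R : realType} {n : nat} {a b : R}.
Implicit Type f : R -> 'cV[R]_n.

(** The interval has finite measure, so L^2 is contained in L^1. *)
Lemma L2_integrable f i : L2 a b f ->
  leb.-integrable `[a, b] (EFin \o (fun x => f x i 0)).
Proof.
move=> /(_ i) L2f; apply: integrable_leb_itv.
apply/Lfun1_integrable/Lfun_subset12 => //.
rewrite /= /mrestr setTI lebesgue_measure_itv/=.
by case: ifPn.
Qed.

Lemma L2_integrable_sqr f i : L2 a b f ->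
  leb.-integrable `[a, b] (EFin \o (fun x => f x i 0 ^+ 2)).
Proof.
by move=> /(_ i) L2f; apply: integrable_leb_itv; exact: Lfun2_integrable_sqr.
Qed.

Lemma L2B f g : L2 a b f -> L2 a b g -> L2 a b (fun x => f x - g x).
Proof.
move=> L2f L2g i.
rewrite (_ : (fun x => _) = (fun x => f x i 0) - (fun x => g x i 0)).
  have p1 : (1 <= 2%:E :> \bar R)%E by rewrite lee1n.
  by apply: (Lfun_addr_closed _ p1).2 => //; exact: Lfun_oppr_closed.
by apply/funext => x; rewrite !mxE.
Qed.

Lemma L2_cst (v : 'cV[R]_n) : L2 a b (fun=> v).
Proof.
move=> i; have leboo : (@lebesgue_measure R `[a, b] < +oo)%E.
  by rewrite lebesgue_measure_itv/=; case: ifPn => //; rewrite -EFinD ltry.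
exact: (Lfun_cst (@mfrestr _ (measurableTypeR R) R `[a, b]
  (@lebesgue_measure R) (measurable_itv `[a, b]) leboo) (v i 0) 2).
Qed.

End L2Itv.

Lemma integrable_itv_cst {R : realType} (a b r : R) :
  leb.-integrable `[a, b] (EFin \o cst r).
Proof.
apply: (@continuous_compact_integrable _ (cst r)); first exact: segment_compact.
by apply: continuous_subspaceT => x; exact: cst_continuous.
Qed.

Lemma Rintegral_itv01_cst {R : realType} (r : R) :
  \int[leb]_(x in `[0, 1]) r = r.
Proof.
by rewrite Rintegral_cst//= lebesgue_measure_itv/= lte_fin ltr01 sube0 mulr1.
Qed.

(* Jensen's inequality for the square, from the nonnegativity of the variance. *)
Lemma sqr_Rintegral_le_Xdot {R : realType} {n : nat} (f : R -> 'cV[R]_n) i :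
  X f -> (\int[leb]_(x in `[0, 1]) f x i 0) ^+ 2 <= Xdot f f.
Proof.
move=> Xf; set m := \int[leb]_(x in _) _.
have intf := L2_integrable f i Xf.
have intmf : leb.-integrable `[0, 1] (EFin \o (fun x => 2 * m * f x i 0)).
  by apply: (integrableZl _ (2 * m) intf).
have intm2 := integrable_itv_cst 0 1 (m ^+ 2).
have m2f : m ^+ 2 <= \int[leb]_(x in `[0, 1]) (f x i 0 * f x i 0).
  have : \int[leb]_(x in `[0, 1]) (2 * m * f x i 0 - m ^+ 2)
      <= \int[leb]_(x in `[0, 1]) (f x i 0 * f x i 0).
    apply: le_Rintegral => //.
    - by apply: (integrableB _ intmf intm2).
    - exact: L2_integrable_sqr.
    - by move=> x _; rewrite -subr_ge0; have := sqr_ge0 (f x i 0 - m); lra.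
  by rewrite RintegralB// RintegralZl// Rintegral_itv01_cst -/m; lra.
apply: (le_trans m2f).
rewrite /Xdot (bigD1 i)//= -[leLHS]addr0 lerD//.
by apply: sumr_ge0 => j _; apply: Rintegral_ge0 => x _; rewrite -expr2 sqr_ge0.
Qed.

(* If [m tau < 0], let [s] be the last time with [m s >= 0]: the equation on
   [s, tau], where [m <= 0], gives [m tau >= m s]. *)
Lemma volterra_ge0 {R : realType} (tau q : R) (m U : R -> R) :
  0 <= tau -> 0 <= q -> {within `[0, tau], continuous m} ->
  0 <= U 0 -> (forall s t, 0 <= s -> s <= t -> t <= tau -> U s <= U t) ->
  (forall t, 0 <= t <= tau -> m t = U t - q * \int[leb]_(s in `[0, t]) m s) ->
  0 <= m tau.
Proof.
move=> tau0 q0 cm U0 ndU mU.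
rewrite leNgt; apply/negP => mtau.
pose A := `[0, tau] `&` [set t | 0 <= m t].
have A0 : A 0.
  split; first by rewrite /= in_itv/= lexx.
  by rewrite /= mU ?lexx// set_itv1 Rintegral_set1 mulr0 subr0.
have cA : closed A.
  have /continuous_closedP/(_ _ (@closed_ge R 0))/closed_subspaceP[V cV VA] := cm.
  have -> : A = V `&` `[0, tau] by rewrite VA setIC.
  by apply: closedI => //; exact: itv_closed.
have supA : has_sup A.
  split; first by exists 0.
  by exists tau => x [/=]; rewrite in_itv/= => /andP[].
have : closure A (sup A).
  by apply: closure_sup; [case: supA|case: supA].
rewrite -((closure_id A).1 cA) => -[].
set s := sup A; rewrite /= in_itv/= => /andP[s0 stau] ms.
have intm : leb.-integrable `[0, tau] (EFin \o m).
  by apply: continuous_compact_integrable => //; exact: segment_compact.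
have : \int[leb]_(x in `]s, tau]) m x <= 0.
  rewrite [leRHS](_ : 0 = \int[leb]_(x in `]s, tau]) 0); last first.
    by rewrite Rintegral_cst// mul0r.
  apply: le_Rintegral => //.
  - by apply: integrableS intm => //; apply: subset_itv; rewrite bnd_simp.
  - exact: integrable0.
  - move=> x /=; rewrite in_itv/= => /andP[sx xtau].
    rewrite leNgt; apply/negP => mx.
    suff: A x by move=> /(ub_le_sup supA.2); rewrite leNgt sx.
    by split; rewrite /= ?in_itv/= ?xtau ?(ltW mx)// (ltW (le_lt_trans s0 sx)).
(* Subtracting the equations at [s] and [tau] gives m(tau) - m(s) = (U(tau) - U(s)) - q int_s^tau m
   >= 0, against m(tau) < 0 <= m(s). *)
rewrite -(@Rintegral_itvB _ _ (BLeft 0))//=.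
have := mU _ (introT andP (conj s0 stau)).
have := mU tau; rewrite lexx tau0 => /(_ isT).
have := ndU _ _ s0 stau (lexx _).
nra.
Qed.

Lemma antiderivative_continuous {R : realType} (a b : R) (F f : R -> R) :
  a <= b -> leb.-integrable `[a, b] (EFin \o f) ->
  (forall x, x \in `[a, b] -> F x = F a + \int[leb]_(t in `[a, x]) f t) ->
  {within `[a, b], continuous F}.
Proof.
move=> ab intf FE.
apply: (@subspace_eq_continuous _ _ _
  (fun x => F a + \int[leb]_(t in `[a, x]) f t)).
  by move=> x /set_mem xab; apply/esym/FE.
move=> x; apply: cvgD; first exact: cvg_cst.
exact: parameterized_integral_continuous.
Qed.

(** * Means of the components of a state *)

(** The division by [b] of the normalised mean is postponed until signs matter. *)
Definition mean {R : realType} {n : nat} (i : 'I_n) (f : R -> 'cV[R]_n) : R :=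
  \int[leb]_(x in `[0, 1]) f x i 0.

(** A constant unit vector is an admissible test function in [Xintegral], so the weak integral in
    time commutes with taking means. *)
Lemma Xdot_delta {R : realType} {n : nat} (f : R -> 'cV[R]_n) i :
  Xdot f (fun=> delta_mx i 0) = mean i f.
Proof.
rewrite /Xdot (bigD1 i)//= big1 ?addr0.
  by apply: eq_Rintegral => x _; rewrite mxE !eqxx mulr1.
move=> j ji; rewrite -[RHS](@Rintegral_itv01_cst R).
by apply: eq_Rintegral => x _; rewrite mxE (negbTE ji) mulr0.
Qed.

Lemma meanB {R : realType} {n : nat} (f g : R -> 'cV[R]_n) i : X f -> X g ->
  mean i (fun x => f x - g x) = mean i f - mean i g.
Proof.
move=> Xf Xg; rewrite -RintegralB//; first by apply: eq_Rintegral => x _; rewrite !mxE.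
  exact: L2_integrable.
exact: L2_integrable.
Qed.

Lemma norm_mean_le {R : realType} {n : nat} (f : R -> 'cV[R]_n) i :
  X f -> `|mean i f| <= Xnorm f.
Proof.
by move=> Xf; rewrite -sqrtr_sqr ler_wsqrtr//; exact: sqr_Rintegral_le_Xdot.
Qed.

(** By [norm_mean_le] the mean is 1-Lipschitz for the norm of X, so it inherits the continuity of
    the trajectory. *)
Lemma mean_continuous {R : realType} {n : nat} (tau : R)
    (z : R -> R -> 'cV[R]_n) i :
  (forall t, t \in `[0, tau] -> X (z t)) -> Xcontinuous tau z ->
  {within `[0, tau], continuous (fun t => mean i (z t))}.
Proof.
move=> Xz cz; apply/subspace_continuousP => t /= t0tau.
apply/cvgrPdist_lt => e e0.
have /cvgrPdist_lt/(_ _ e0) := cz t t0tau.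
have : \forall s \near within `[0, tau] (nbhs t), s \in `[0, tau].
  exact: withinT.
apply: filterS2 => s s0tau; rewrite sub0r normrN; apply: le_lt_trans.
rewrite distrC -meanB; [|exact: Xz..].
rewrite [leRHS]ger0_norm ?sqrtr_ge0//; apply: norm_mean_le.
by apply: L2B; exact: Xz.
Qed.

(** Integrability of [ddw] makes [dw] continuous, hence integrable, and the same argument then
    applies to [w]. *)
Lemma H2_continuous {R : realType} {n : nat} (w dw ddw : R -> 'cV[R]_n) i :
  H2 w dw ddw -> {within `[0, 1], continuous (fun x => w x i 0)}.
Proof.
move=> [Xddw wE].
have cdw : {within `[0, 1], continuous (fun x => dw x i 0)}.
  apply: (@antiderivative_continuous _ _ _ _ (fun x => ddw x i 0)) => //.
    exact: L2_integrable.
  by move=> x /wE[_ ->]; rewrite !mxE.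
apply: (@antiderivative_continuous _ _ _ _ (fun x => dw x i 0)) => //.
  by apply: continuous_compact_integrable => //; exact: segment_compact.
by move=> x /wE[-> _]; rewrite !mxE.
Qed.

(** * The scalar equation of a mean and its sign *)

(** Integrate the i-th row of the time-integrated equation over [0, 1]: the diffusion term reduces
    to boundary values of [dw], and the vanishing row of [B] removes the coupling, leaving only the
    control. *)
Lemma mild_solution_mean {R : realType} {n : nat} (c q : 'rV[R]_n)
    (B K : 'M[R]_n) tau h u z i t :
  mild_solution (diag_mx c) (diag_mx q) B K tau h u z -> X h ->
  row i B = 0 -> t \in `[0, tau] ->
  mean i (z t) = mean i h + c 0 i * (K *m vint 0 t u) i 0
    - q 0 i * \int[leb]_(s in `[0, t]) mean i (z s).
Proof.
move=> [Xz _ zE] Xh B0 t0tau.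
have [w [dw [ddw [H2w intw zhE dw1 dw0]]]] := zE t t0tau.
have [Xddw wE] := H2w.
have -> : \int[leb]_(s in `[0, t]) mean i (z s) = mean i w.
  rewrite -Xdot_delta intw; last exact: L2_cst.
  by apply: eq_Rintegral => s _; rewrite Xdot_delta.
have cddw : c 0 i * (K *m vint 0 t u) i 0 = c 0 i * mean i ddw.
  (* The integral of [ddw] over [0, 1] is [dw 1 - dw 0], and both traces are prescribed. *)
  have [|_] := wE 1; first by rewrite in_itv/= ler01 lexx.
  rewrite dw1 dw0 add0r => /matrixP/(_ i 0).
  have : row i (B *m w 0) 0 0 = 0 by rewrite row_mul B0 mul0mx mxE.
  rewrite mxE => Bw0; rewrite mxE Bw0 add0r => ->.
  by rewrite mxE.
have intw1 : leb.-integrable `[0, 1] (EFin \o (fun x => w x i 0)).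
  apply: continuous_compact_integrable; first exact: segment_compact.
  exact: H2_continuous H2w.
have intddw := L2_integrable ddw i Xddw.
have intcddw : leb.-integrable `[0, 1] (EFin \o (fun x => c 0 i * ddw x i 0)).
  by apply: (integrableZl _ _ intddw).
have intqw : leb.-integrable `[0, 1] (EFin \o (fun x => q 0 i * w x i 0)).
  by apply: (integrableZl _ _ intw1).
have Xzh : X (fun x => z t x - h x) by apply: L2B => //; exact: Xz.
have : mean i (fun x => z t x - h x) =
    \int[leb]_(x in `[0, 1]) (c 0 i * ddw x i 0 - q 0 i * w x i 0).
  congr fine; apply: ae_eq_integral => //.
  - by apply: measurable_int; exact: L2_integrable.
  - by apply: measurable_int; exact: (integrableB _ intcddw intqw).
  - move: (ae_leb_itv _ _ _ zhE).
    apply: filterS; first exact: (ae_filter_ringOfSetsType leb).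
    move=> x /[apply] /matrixP/(_ i 0) ->.
    by rewrite !mul_diag_mx !mxE.
rewrite meanB//; last exact: Xz.
rewrite RintegralB// !RintegralZl// cddw /mean.
move=> /eqP; rewrite subr_eq => /eqP ->.
by rewrite addrC addrA.
Qed.

Lemma positive_control_mono {R : realType} {n : nat} (tau : R)
    (u : R -> 'cV[R]_n) i s t :
  positive_control tau u -> 0 <= s -> s <= t -> t <= tau ->
  \int[leb]_(x in `[0, s]) u x i 0 <= \int[leb]_(x in `[0, t]) u x i 0.
Proof.
move=> [L2u u0] s0 st ttau.
have intu := L2_integrable u i L2u.
have intut : leb.-integrable `[0, t] (EFin \o (fun x => u x i 0)).
  by apply: integrableS intu => //; apply: subset_itvl.
have intust : leb.-integrable `]s, t] (EFin \o (fun x => u x i 0)).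
  by apply: integrableS intut => //; apply: subset_itvr.
rewrite -subr_ge0 (@Rintegral_itvB _ _ (BLeft 0))//.
(* The control is nonnegative only almost everywhere; its absolute value is an a.e. equal integrand
   that is nonnegative at every point. *)
rewrite [leRHS](_ : _ = \int[leb]_(x in `]s, t]) `|u x i 0|).
  by apply: Rintegral_ge0 => x _.
congr fine; apply: ae_eq_integral => //.
- exact: measurable_int intust.
- exact: measurable_int (integrable_norm intust).
move: (ae_leb_itv _ _ _ u0).
apply: filterS; first exact: (ae_filter_ringOfSetsType leb).
move=> x u0x sxt; rewrite ger0_norm// u0x//.
by apply: subset_itv sxt; rewrite bnd_simp.
Qed.

(** Dividing the mean by [b] cancels the factor carried by [K], whatever its sign; [volterra_ge0]
    then applies with the nondecreasing forcing U(t) = c_i int_0^t u_i. *)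
Lemma positive_reachable_mean {R : realType} {n : nat} (c q : 'rV[R]_n)
    (B K : 'M[R]_n) (b : R) i f :
  0 <= c 0 i -> 0 <= q 0 i -> b != 0 -> row i B = 0 ->
  row i K = b *: delta_mx 0 i ->
  positive_reachable (diag_mx c) (diag_mx q) B K f ->
  X f /\ 0 <= mean i f / b.
Proof.
move=> c0 q0 b0 B0 Kb [tau [u [z [tau0 posu mz ->]]]].
have [Xz cz _] := mz.
split; first by apply: Xz; rewrite in_itv/= lexx ltW.
have int_mean : leb.-integrable `[0, tau] (EFin \o (fun t => mean i (z t))).
  apply: continuous_compact_integrable; first exact: segment_compact.
  exact: mean_continuous.
apply: (@volterra_ge0 _ tau (q 0 i) (fun t => mean i (z t) / b)
  (fun t => c 0 i * \int[leb]_(x in `[0, t]) u x i 0)) => //; first exact: ltW.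
- move=> t; apply: cvgM; last exact: cvg_cst.
  exact: mean_continuous.
- by rewrite set_itv1 Rintegral_set1 mulr0.
- by move=> s t s0 st ttau; rewrite ler_wpM2l//; exact: positive_control_mono posu _ _ _.
- move=> t t0tau.
  rewrite RintegralZr//; last first.
    apply: integrableS int_mean => //; apply: subset_itvl.
    by case/andP: t0tau => _; rewrite bnd_simp.
  have KE : (K *m vint 0 t u) i 0 = b * \int[leb]_(x in `[0, t]) u x i 0.
    have -> : (K *m vint 0 t u) i 0 = row i (K *m vint 0 t u) 0 0.
      by rewrite [RHS]mxE.
    by rewrite row_mul Kb -scalemxAl -rowE [LHS]mxE [X in _ * X]mxE mxE.
  rewrite (mild_solution_mean _ _ _ _ _ _ _ _ _ _ mz)//; last exact: (L2_cst 0).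
  rewrite KE (_ : mean i _ = 0); first by field.
  rewrite /mean -[RHS]Rintegral_itv01_cst.
  by apply: eq_Rintegral => x _; rewrite mxE.
Qed.

Theorem lemma5p5 (R : realType) (c q : 'rV[R]_3) (b : R)
    (hc : forall j, 0 < c 0 j) (hq : forall j, 0 < q 0 j) (hb : b != 0) :
  ~ approx_controllable_positive (diag_mx c) (diag_mx q)
      (path_adjacency R) (start_control b).
Proof.
move=> dense.
(* The target lies on the wrong side of the half-space, at a distance no smaller than the tolerance
   [|b|]. *)
have [|f] := dense (fun=> const_mx (- b)) (L2_cst _) `|b|.
  by rewrite normr_gt0.
move=> reach_f.
have [||Xf fb] := positive_reachable_mean _ _ _ _ b ord0 f
  (ltW (hc _)) (ltW (hq _)) hb _ _ reach_f.
(* Row 0 of the adjacency matrix vanishes because 0 is never a successor. *)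
- by apply/rowP => j; rewrite !mxE.
- by apply/rowP => j; rewrite !mxE eqxx/=; case: eqP; rewrite ?mulr1 ?mulr0.
apply/negP; rewrite -leNgt.
apply: le_trans (norm_mean_le _ ord0 (L2B _ _ (L2_cst _) Xf)).
rewrite meanB//; last exact: L2_cst.
have -> : mean ord0 (fun=> const_mx (- b) : 'cV[R]_3) = - b.
  by rewrite /mean -[RHS]Rintegral_itv01_cst; apply: eq_Rintegral => x _; rewrite mxE.
(* The second factor is at least 1 because [mean ord0 f / b] is nonnegative. *)
rewrite (_ : - b - mean ord0 f = - b * (1 + mean ord0 f / b)); last by field.
by rewrite normrM normrN ler_peMr// ger0_norm; lra.
Qed.
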